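(* Let $\mathcal{D}=(\mathcal{P},\mathcal{B})$ be a nontrivial $2$-$(v,k,\lambda)$ design with replication number $r$, and let $G\le \mathrm{Aut}(\mathcal{D})$ be a half-flag-transitive automorphism group of $\mathcal{D}$. Then each of the following conditions implies that $G$ is point-primitive: (i) $\lambda\ge \gcd(r,2\lambda)^2$; (ii) $r>4\lambda(k-2)$; (iii) $\gcd(v-1,2k-2)\le 2$.
   Context: A $2$-$(v,k,\lambda)$ design $\mathcal{D}=(\mathcal{P},\mathcal{B})$ consists of a finite set $\mathcal{P}$ of $v$ points and a set $\mathcal{B}$ of $b$ blocks, each block being a $k$-subset of $\mathcal{P}$, such that each pair of distinct points is contained in exactly $\lambda$ blocks ($\lambda\ge 1$). The replication number $r$ is the number of blocks containing a given point (it is independent of the point). The design is nontrivial if $2<k<v-1$. An automorphism of $\mathcal{D}$ is a permutation of $\mathcal{P}$ preserving $\mathcal{B}$; these form the group $\mathrm{Aut}(\mathcal{D})$. A subgroup $G\le\mathrm{Aut}(\mathcal{D})$ is half-flag-transitive if it acts transitively on $\mathcal{B}$ and, for every block $B\in\mathcal{B}$, the setwise stabilizer $G_B$ has exactly two orbits on the set of points of $B$, each of size $k/2$. $G$ is point-primitive if the only $G$-invariant partitions of $\mathcal{P}$ are the partition into singletons and the partition $\{\mathcal{P}\}$. *)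

(* Defs.v *)
From mathcomp Require Import all_boot all_fingroup all_solvable.

Set Implicit Arguments.
Unset Strict Implicit.
Unset Printing Implicit Defensive.

Local Open Scope group_scope.

Definition is_2design (T : finType) (B : {set {set T}}) (v k lambda : nat) :=
  [/\ #|T| = v,
      forall b : {set T}, b \in B -> #|b| = k,
      forall x y : T, x != y ->
        #|[set b in B | (x \in b) && (y \in b)]| = lambda
    & 1 <= lambda].

Definition nontrivial_design (v k : nat) := 2 < k /\ k < v.-1.

Definition replication_number (T : finType) (B : {set {set T}}) (r : nat) :=
  forall x : T, #|[set b in B | x \in b]| = r.

(* 'P^* is the action of permutations on sets of points, g sending b to
   g @: b, so this is the group of permutations g of T such that g @: b \in B
   for all b \in B; as B is finite, these map B onto itself. *)
Definition design_aut (T : finType) (B : {set {set T}}) : {group {perm T}} :=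
  'N(B | 'P^*)%G.

(* 'N_G(b | 'P) is the setwise stabiliser of b. The size k / 2 of its orbits
   on b is to be read as exact division, hence the doubling. *)
Definition half_flag_transitive (T : finType) (B : {set {set T}}) (k : nat)
    (G : {group {perm T}}) :=
  [transitive G, on B | 'P^*] /\
  forall b : {set T}, b \in B ->
    let orbits := [set orbit 'P 'N_G(b | 'P) x | x in b] in
    #|orbits| = 2 /\ forall O : {set T}, O \in orbits -> (2 * #|O|)%N = k.

Definition point_primitive (T : finType) (G : {group {perm T}}) : bool :=
  [primitive G, on [set: T] | 'P].

(* The library notion of primitivity asks for transitivity and excludes the
   invariant partitions Q with 1 < #|Q| < #|T|. On more than two points this
   says that the partition into singletons and the partition [set setT] are
   the only invariant ones (on two points the trivial group satisfies the
   latter without being transitive). *)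
Lemma point_primitiveP (T : finType) (G : {group {perm T}}) :
  2 < #|T| ->
  point_primitive G <->
  (forall Q : {set {set T}}, partition Q [set: T] -> [acts G, on Q | 'P^*] ->
     Q = [set [set x] | x in [set: T]] \/ Q = [set [set: T]]).
Proof.
move=> T_gt2; have [x0 _] : exists x : T, x \in T.
  by apply/card_gt0P; apply: leq_trans T_gt2.
split=> [/andP[_ /existsPn primG] Q parQ actQ | trivG].
  have := primG Q; rewrite /imprimitivity_system parQ actQ /= cardsT.
  have [/eqP covQ trQ Q0] := and3P parQ.
  have neQ A : A \in Q -> 0 < #|A|.
    by move=> QA; rewrite card_gt0; apply: contraNneq Q0 => <-.
  rewrite negb_and -!leqNgt => /orP[Qle1 | Qge].
    right; have /bigcupP[A QA _] : x0 \in cover Q by rewrite covQ inE.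
    have defQ : Q = [set A].
      by apply/eqP; rewrite eq_sym eqEcard sub1set QA cards1.
    by rewrite defQ; rewrite defQ /cover big_set1 in covQ; rewrite covQ.
  left; have A1 A : A \in Q -> #|A| = 1%N.
    move=> QA; apply/eqP; rewrite eqn_leq neQ // andbT.
    have := card_partition parQ; rewrite cardsT => eT.
    move: Qge; rewrite eT (bigD1 A) //= (cardD1 A) QA /= => Qge.
    have le : #|[predD1 Q & A]| <= \sum_(i in Q | i != A) #|i|.
      rewrite -sum1_card (eq_bigl (fun i => (i \in Q) && (i != A))).
        by apply: leq_sum => i /andP[/neQ].
      by move=> i; rewrite !inE andbC.
    rewrite -(leq_add2r (\sum_(i in Q | i != A) #|i|)).
    by apply: leq_trans Qge _; rewrite leq_add2l.
  apply/setP=> A; apply/idP/imsetP=> [QA | [x _ ->]].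
    by have /eqP/cards1P[x ->] := A1 A QA; exists x; rewrite ?inE.
  have /bigcupP[C QC Cx] : x \in cover Q by rewrite covQ inE.
  have /eqP/cards1P[y defC] := A1 C QC.
  by move: Cx QC; rewrite defC inE => /eqP <-.
pose S2 : {set {set T}} := [set [set x0]; ~: [set x0]].
have cN1 : #|~: [set x0]| = #|T|.-1 by rewrite cardsC1.
have parS2 : partition S2 [set: T].
  apply/and3P; split.
  - apply/eqP/setP=> y; rewrite inE; apply/bigcupP.
    have [->|ny] := eqVneq y x0; first by exists [set x0]; rewrite !inE ?eqxx.
    by exists (~: [set x0]); rewrite !inE ?eqxx ?orbT.
  - apply/trivIsetP=> A C /set2P[]-> /set2P[]-> //; rewrite ?eqxx // => _.
      by rewrite -setI_eq0 setICr.
    by rewrite -setI_eq0 setIC setICr.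
  rewrite !inE negb_or ![set0 == _]eq_sym -!cards_eq0 cards1 cN1.
  by case: #|T| T_gt2 => [|[|]].
have S2neq : #|S2| = 2.
  rewrite cards2; suff -> : [set x0] != ~: [set x0] by [].
  by apply/eqP=> /setP/(_ x0); rewrite !inE eqxx.
have S2F (actS2 : [acts G, on S2 | 'P^*]) : False.
  case: (trivG S2 parS2 actS2) => defS2; move: S2neq; rewrite defS2.
    rewrite card_imset ?cardsT; last exact: set1_inj.
    by move=> e; rewrite e in T_gt2.
  by rewrite cards1.
apply/andP; split.
  have actT : [acts G, on [set: T] | 'P] by apply/actsP=> a _ x; rewrite !inE.
  pose Q := orbit 'P G @: [set: T].
  have parQ : partition Q [set: T] by apply: orbit_partition.
  have fixQ a A : a \in G -> A \in Q -> ('P^*)%act A a = A.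
    move=> Ga /imsetP[x _ ->]; apply/eqP; rewrite eqEcard card_setact leqnn andbT.
    apply/subsetP=> _ /imsetP[_ /imsetP[b Gb ->] ->].
    by rewrite -actM mem_orbit ?groupM.
  have actQ : [acts G, on Q | 'P^*].
    apply/subsetP=> a Ga; rewrite !inE; apply/subsetP=> A QA.
    by rewrite inE fixQ.
  case: (trivG Q parQ actQ) => defQ; last first.
    apply/imsetP; exists x0; rewrite ?inE //.
    have : orbit 'P G x0 \in Q by apply: imset_f; rewrite inE.
    by rewrite defQ inE => /eqP.
  case: S2F; apply/subsetP=> a Ga.
  have a1 : a = 1.
    apply/permP=> x; rewrite perm1.
    have /(fixQ a _ Ga) : [set x] \in Q by rewrite defQ imset_f ?inE.
    by rewrite /= /setact imset_set1 => /set1_inj.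
  by rewrite a1 group1.
apply/existsPn=> Q; apply/negP=> /and3P[parQ actQ].
rewrite cardsT.
case: (trivG Q parQ actQ) => ->; last by rewrite cards1.
by rewrite card_imset ?cardsT ?ltnn ?andbF //; exact: set1_inj.
Qed.

(* Main.v *)
Require Import Defs.
From mathcomp Require Import all_boot all_fingroup all_solvable.
From mathcomp Require Import all_algebra zify.

(** The argument turns an imprimitivity system into numerical data, and then
    plays divisibility and size estimates against each other.

    A half-flag-transitive group is block-transitive, hence point-transitive
    ([block_transitive_point_transitive]). If it preserves a partition of the
    points into c classes of size d, with c, d > 1, count the triples (b, x, y)
    such that x, y lie in b and in the same class. For a fixed x there are
    r + lambda (d - 1) of them. For a fixed b the number of y depends only on
    the orbit of x under the stabiliser of b, and these orbits have size k/2,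
    so there are (k/2) s triples for some integer s, the same for all blocks.
    Since #|B| k = v r, comparison gives r s = 2 (r + lambda (d - 1)), that is,
    with t = s - 2 > 0,
      r t = 2 lambda (d - 1)                ([imprimitive_parameters]),
    next to v = c d and the classical r (k - 1) = lambda (v - 1).

    Each of the three conditions contradicts these equations:
    - [gcd_square_bound]: q = r / gcd(r, 2 lambda) divides d - 1 and v - 1,
      hence also c - 1 = (v - 1) - c (d - 1), so that v >= (q + 1)^2. On the
      other hand lambda (v - 1) = r (k - 1) < r^2, because r >= k by Fisher's
      inequality ([fisher]); hence lambda < gcd(r, 2 lambda)^2.
    - [replication_bound]: subtracting c times the second equation from twice
      the classical one leaves
        r (2 (k - 1) - c t) = 2 lambda (c - 1).
      The right side is positive, so the integer factor on the left is at
      least 1. This bounds r by 2 lambda (c - 1), and c by 2 k - 3.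
    - [gcd_bound]: eliminating r and lambda gives
      (2 k - 2)(d - 1) = t (v - 1), so (v - 1) / gcd(v - 1, 2 k - 2) divides
      d - 1, whereas v >= 2 d. *)

Set Implicit Arguments.
Unset Strict Implicit.
Unset Printing Implicit Defensive.

Import GRing.Theory Num.Theory.

(** * Counting in designs *)

(** Double counting the pairs (y, b) with x, y in b, each weighted by w y: the
    point x itself occurs r times, every other point lambda times. Natural
    weights give the elementary counts below, and rational ones are the row
    vectors of Fisher's inequality. *)
Lemma sum_weight_through (V : nmodType) (T : finType) (B : {set {set T}})
    (v k lambda r : nat) (w : T -> V) (x : T) :
  is_2design B v k lambda -> replication_number B r ->
  (\sum_(b in B | x \in b) \sum_(y in b) w y =
   w x *+ r + (\sum_(y | y != x) w y) *+ lambda)%R.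
Proof.
move=> [_ _ pairB _] repB.
rewrite (exchange_big_dep predT) //= (bigD1 x) //= -sumrMnl; congr (_ + _)%R.
  rewrite sumr_const -(repB x); congr (_ *+ _)%R.
  by apply: eq_card => b; rewrite !inE unfold_in -andbA andbb.
apply: eq_bigr => y ney; rewrite sumr_const -(pairB x y) 1?eq_sym //.
by congr (_ *+ _)%R; apply: eq_card => b; rewrite !inE unfold_in -andbA.
Qed.

Lemma sum_card_through (T : finType) (B : {set {set T}})
    (v k lambda r : nat) (x : T) (A : {set T}) :
  is_2design B v k lambda -> replication_number B r ->
  \sum_(b in B | x \in b) #|b :&: A| = r * (x \in A) + lambda * #|A :\ x|.
Proof.
move=> desB repB; pose w (y : T) := nat_of_bool (y \in A).
have wE (P : pred T) : \sum_(y | P y) w y = #|[set y in A | P y]|.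
  rewrite -sum1_card [RHS](eq_bigl (fun y => P y && (y \in A))).
    by rewrite -big_mkcondr.
  by move=> y; rewrite !inE andbC.
have := sum_weight_through w x desB repB.
have mulrnE (m n : nat) : (m *+ n)%R = n * m by rewrite -mulr_natr natn mulnC.
rewrite !mulrnE => sumE.
transitivity (\sum_(b in B | x \in b) \sum_(y in b) w y).
  apply: eq_bigr => b _; rewrite wE; apply: eq_card => y.
  by rewrite !inE andbC.
rewrite [LHS]sumE; congr (_ + _).
congr (_ * _); rewrite [LHS]wE; apply: eq_card => y.
by rewrite !inE andbC.
Qed.

Lemma design_point_count (T : finType) (B : {set {set T}})
    (v k lambda r : nat) :
  is_2design B v k lambda -> replication_number B r -> 0 < v ->
  r * (k - 1) = lambda * (v - 1).
Proof.
move=> desB repB v_gt0; have [cardT cardB _ _] := desB.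
have [x _] : exists x : T, x \in T by apply/card_gt0P; rewrite cardT.
have := sum_card_through x [set: T] desB repB.
have -> : #|[set: T] :\ x| = v - 1.
  by rewrite -cardT -cardsT (cardsD1 x [set: T]) inE; lia.
rewrite inE (eq_bigr (fun=> k)) => [|b /andP[Bb _]]; last first.
  by rewrite setIT cardB.
rewrite sum_nat_const.
have -> : #|[pred b | (b \in B) && (x \in b)]| = r.
  by rewrite -(repB x); apply: eq_card => b; rewrite !inE.
by move=> sumE; rewrite [r * (k - 1)]mulnBr sumE !muln1 addKn.
Qed.

Lemma design_flag_count (T : finType) (B : {set {set T}})
    (v k lambda r : nat) :
  is_2design B v k lambda -> replication_number B r -> #|B| * k = v * r.
Proof.
move=> [<- cardB _ _] repB.
transitivity (\sum_(b in B) \sum_(x in b) 1).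
  by rewrite -sum_nat_const; apply: eq_bigr => b Bb; rewrite sum1_card cardB.
rewrite (exchange_big_dep predT) //= -sum_nat_const; apply: eq_bigr => x _.
by rewrite -(repB x) -sum1_card; apply: eq_bigl => b; rewrite !inE.
Qed.

(** Fisher's inequality: a rational weight w of sum 0 on every block has, by
    the pair count at x, (r - lambda) w x + lambda S = 0 where S is its total.
    Summing over x gives (r - lambda + lambda v) S = 0, so S = 0 and then
    w = 0. Thus the incidence matrix has independent rows, one per point. *)
Lemma fisher (T : finType) (B : {set {set T}}) (v k lambda r : nat) :
  is_2design B v k lambda -> replication_number B r -> lambda < r ->
  v <= #|B|.
Proof.
move=> desB repB lt_lr; have [<- _ _ _] := desB.
pose N : 'M[rat]_(#|T|, #|B|) :=
  (\matrix_(i, j) (@enum_val T T i \in @enum_val {set T} (mem B) j)%:R)%R.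
suff /eqP <- : row_free N by exact: rank_leq_col.
apply: inj_row_free => u uN0.
pose w x := (u ord0 (enum_rank x))%R; pose S := (\sum_x w x)%R.
have sum_w0 b : b \in B -> (\sum_(y in b) w y = 0)%R.
  move=> Bb; have /rowP/(_ (enum_rank_in Bb b)) := uN0.
  rewrite !mxE => uNb; rewrite -[RHS]uNb.
  rewrite (reindex (@enum_val T T)) /=; last exact/onW_bij/enum_val_bij.
  rewrite big_mkcond; apply: eq_bigr => i _.
  rewrite mxE enum_rankK_in // /w enum_valK.
  by case: (_ \in b); rewrite ?mulr1 ?mulr0.
have wE x : (w x *+ (r - lambda) = - (S *+ lambda))%R.
  have := sum_weight_through w x desB repB.
  rewrite big1 => [|b /andP[Bb _]]; last exact: sum_w0.
  rewrite -{1}(subnK (ltnW lt_lr)) mulrnDr -addrA -mulrnDl.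
  have -> : (w x + \sum_(y | y != x) w y)%R = S by rewrite [RHS](bigD1 x).
  by move=> /esym/eqP; rewrite addr_eq0 => /eqP.
have S0 : S = 0%R.
  have : (S *+ (r - lambda + lambda * #|T|) = 0)%R.
    rewrite mulrnDr {1}/S -sumrMnl (eq_bigr _ (fun x _ => wE x)) sumr_const.
    by rewrite mulNrn -mulrnA addNr.
  by move/eqP; rewrite mulrn_eq0 => /orP[|/eqP //]; lia.
apply/rowP=> i; rewrite mxE.
have /eqP := wE (enum_val i).
by rewrite S0 mul0rn oppr0 mulrn_eq0 /w enum_valK => /orP[|/eqP //]; lia.
Qed.

(** * From block-transitivity to point-transitivity *)

(** Block-transitivity makes a point orbit O meet all blocks in the same number
    n of points. Counting pairs at x gives r n = r + lambda (#|O| - 1) when x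
    lies in O, but r n = lambda #|O| when it does not; as lambda < r, only one
    of the two cases can occur. *)
Lemma block_transitive_point_transitive (T : finType) (B : {set {set T}})
    (v k lambda r : nat) (G : {group {perm T}}) :
  is_2design B v k lambda -> replication_number B r -> 0 < v -> lambda < r ->
  [transitive G, on B | 'P^*] -> [transitive G, on [set: T] | 'P].
Proof.
move=> desB repB v_gt0 lt_lr trB; have [cardT _ _ _] := desB.
have [b0 Bb0 defB] := imsetP trB.
have [x0 _] : exists x : T, x \in T.
  by apply/card_gt0P; rewrite cardT.
pose O := orbit 'P G x0.
have gO g : g \in G -> ('P^*)%act O g = O.
  move=> Gg; apply/eqP; rewrite eqEcard card_setact leqnn andbT.
  apply/subsetP=> _ /imsetP[_ /imsetP[a Ga ->] ->].
  by rewrite -actM mem_orbit ?groupM.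
have capO b : b \in B -> #|b :&: O| = #|b0 :&: O|.
  rewrite defB => /imsetP[g Gg ->]; rewrite -[RHS](card_setact 'P _ g).
  rewrite -{1}(gO g Gg) /= /setact imsetI // => ? ? _ _; exact: act_inj.
have sumO x : r * #|b0 :&: O| = r * (x \in O) + lambda * #|O :\ x|.
  rewrite -(sum_card_through x O desB repB).
  rewrite (eq_bigr _ (fun b bP => capO b (proj1 (andP bP)))) sum_nat_const.
  congr (_ * _); rewrite -(repB x).
  by apply: eq_card => b; rewrite !inE.
apply/imsetP; exists x0 => //; apply/eqP; rewrite eq_sym -subTset.
apply/subsetP=> x _; apply: contraTT lt_lr => nOx; rewrite -leqNgt.
have := sumO x; rewrite (sumO x0) orbit_refl (negPf nOx).
have := cardsD1 x0 O; have := cardsD1 x O; rewrite orbit_refl (negPf nOx).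
nia.
Qed.

(** * Parameters of an imprimitivity system *)

(** The hypothesis on orbit sizes enters only here: summed over one orbit of the
    block stabiliser, f contributes k / 2 times its constant value there. *)
Lemma half_flag_sum_invariant (T : finType) (B : {set {set T}}) (k : nat)
    (G : {group {perm T}}) (b : {set T}) (f : T -> nat) :
  half_flag_transitive B k G -> b \in B ->
  {in b & 'N_G(b | 'P)%g, forall x g, f ('P%act x g) = f x} ->
  exists s, 2 * \sum_(x in b) f x = k * s.
Proof.
move=> [_ /(_ b)] orbG Bb fG; have /= [_ cardO] := orbG Bb.
have actb : [acts 'N_G(b | 'P)%g, on b | 'P] by rewrite subsetIr.
rewrite (set_partition_big _ (orbit_partition actb)) big_distrr /=.
(* Orbits are nonempty, so the default value 0 is never taken. *)
exists (\sum_(O in orbit 'P 'N_G(b | 'P)%g @: b)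
          if [pick x in O] is Some x then f x else 0).
rewrite [RHS]big_distrr /=; apply: eq_bigr => O bO.
rewrite -(cardO O bO) -mulnA; congr (2 * _); case/imsetP: bO => x bx ->.
case: pickP => [y xy | /(_ x)]; last by rewrite orbit_refl.
have fO z : z \in orbit 'P 'N_G(b | 'P)%g x -> f z = f x.
  by case/imsetP=> g Ng ->; apply: fG.
by rewrite (fO y xy) (eq_bigr _ fO) sum_nat_const.
Qed.

Lemma pblock_setact (T : finType) (G : {group {perm T}}) (Q : {set {set T}})
    (g : {perm T}) (x : T) :
  partition Q [set: T] -> [acts G, on Q | 'P^*] -> g \in G ->
  pblock Q ('P%act x g) = ('P^*)%act (pblock Q x) g.
Proof.
move=> /and3P[/eqP covQ trivQ _] actQ Gg.
have Qx : x \in cover Q by rewrite covQ inE.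
apply: def_pblock => //; first by rewrite (acts_act actQ) ?pblock_mem.
by apply: imset_f; rewrite mem_pblock.
Qed.

Lemma transitive_partition_uniform (T : finType) (G : {group {perm T}})
    (Q : {set {set T}}) :
  [transitive G, on [set: T] | 'P] ->
  partition Q [set: T] -> [acts G, on Q | 'P^*] ->
  exists d, {in Q, forall A : {set T}, #|A| = d}.
Proof.
move=> trG parQ actQ; have [x0 _ defT] := imsetP trG.
have [/eqP covQ trivQ Q0] := and3P parQ.
exists #|pblock Q x0| => A QA.
have /set0Pn[x Ax] : A != set0 by apply: contraNneq Q0 => <-.
have /imsetP[g Gg def_x] : x \in orbit 'P G x0 by rewrite -defT inE.
rewrite -(def_pblock trivQ QA Ax) def_x (pblock_setact _ parQ actQ Gg).
exact: card_setact.
Qed.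

(** Here c and d are the number and the size of the classes, and t + 2 is the
    sum over the two halves of a block b of the number of points that b shares
    with the class of a point of that half. *)
Lemma imprimitive_parameters (T : finType) (B : {set {set T}})
    (v k lambda r : nat) (G : {group {perm T}}) :
  is_2design B v k lambda -> replication_number B r ->
  0 < v -> lambda < r -> half_flag_transitive B k G ->
  ~~ point_primitive G ->
  exists c d t, [/\ 1 < c, 1 < d, 0 < t, v = c * d
                  & r * t = 2 * lambda * (d - 1)].
Proof.
move=> desB repB v_gt0 lt_lr hftG; have [trB _] := hftG.
have [cardT cardB _ lambda_gt0] := desB.
have trG := block_transitive_point_transitive desB repB v_gt0 lt_lr trB.
rewrite /point_primitive /primitive trG /= negbK => /existsP[Q].
case/and4P=> parQ actQ c_gt1; rewrite cardsT cardT => c_ltv.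
have [/eqP covQ trivQ Q0] := and3P parQ.
have [d cardQ] := transitive_partition_uniform trG parQ actQ.
have def_v : v = #|Q| * d.
  by rewrite -cardT -cardsT (card_uniform_partition cardQ parQ).
have d_gt1 : 1 < d by nia.
pose f b x := #|b :&: pblock Q x|.
have fG b x g : g \in G -> f (('P^*)%act b g) ('P%act x g) = f b x.
  move=> Gg; rewrite /f (pblock_setact x parQ actQ Gg).
  rewrite -[RHS](card_setact 'P _ g).
  by rewrite /= /setact imsetI // => ? ? _ _; exact: act_inj.
have [b0 Bb0 defB] := imsetP trB.
(* Half of k * s is the number of ordered pairs of points of b0 that lie in a
   common class. *)
have [s def_s] : exists s, 2 * \sum_(x in b0) f b0 x = k * s.
  apply: (half_flag_sum_invariant hftG Bb0) => x g bx /setIP[Gg Nb].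
  rewrite -[RHS](fG b0 x g Gg); congr (f _ _).
  by move: Nb; rewrite -astab1_set => /astab1P.
have sum_f b : b \in B -> \sum_(x in b) f b x = \sum_(x in b0) f b0 x.
  rewrite defB => /imsetP[g Gg ->]; rewrite big_imset /=; last first.
    by move=> ? ? _ _; exact: act_inj.
  by apply: eq_bigr => x _; rewrite fG.
have sum_through x : \sum_(b in B | x \in b) f b x = r + lambda * (d - 1).
  have Qx : x \in cover Q by rewrite covQ inE.
  rewrite (sum_card_through x (pblock Q x) desB repB) mem_pblock Qx muln1.
  have := cardsD1 x (pblock Q x); rewrite mem_pblock Qx cardQ ?pblock_mem //.
  by move=> ->; rewrite addKn.
have count : #|B| * \sum_(x in b0) f b0 x = v * (r + lambda * (d - 1)).
  rewrite -sum_nat_const -(eq_bigr _ sum_f) (exchange_big_dep predT) //=.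
  by rewrite (eq_bigr _ (fun x _ => sum_through x)) sum_nat_const cardT.
have flags := design_flag_count desB repB.
(* The factor v is what allows #|B| * k to be traded for v * r. *)
have r_s : r * s = 2 * r + 2 * lambda * (d - 1).
  apply/eqP; rewrite -(eqn_pmul2l v_gt0); apply/eqP.
  rewrite mulnA -flags -mulnA -def_s mulnCA count; nia.
(* Classes have at least two points, so the last summand is positive and s
   exceeds 2. *)
have s_gt2 : 2 < s by nia.
exists #|Q|, d, (s - 2); split=> //; first by rewrite subn_gt0.
by rewrite mulnBr r_s; nia.
Qed.

(** * Numerical contradictions *)

(** The quotient q of r by the gcd divides d - 1 and c - 1, so v > q ^ 2;
    k <= r, Fisher's inequality, keeps lambda (v - 1) below r ^ 2. *)
Lemma gcd_square_bound (v k lambda r c d t : nat) :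
  0 < r -> k <= r -> 0 < lambda -> 1 < c -> 1 < d -> v = c * d ->
  r * (k - 1) = lambda * (v - 1) -> r * t = 2 * lambda * (d - 1) ->
  lambda < gcdn r (2 * lambda) ^ 2.
Proof.
move=> r_gt0 le_kr lambda_gt0 c_gt1 d_gt1 def_v count class_count.
rewrite ltnNge; apply/negP.
have /dvdnP[q def_r] := dvdn_gcdl r (2 * lambda).
have gcd_gt0 : 0 < gcdn r (2 * lambda) by rewrite gcdn_gt0 r_gt0.
have div_q n : r %| 2 * lambda * n -> q %| n.
  move=> r_n; rewrite -(@dvdn_pmul2r (gcdn r (2 * lambda))) //.
  by rewrite -def_r mulnC muln_gcdl dvdn_gcd [_ * n]mulnC dvdn_mull // r_n.
have /dvdnP[m def_d] : q %| d - 1.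
  by apply: div_q; rewrite -class_count dvdn_mulr.
have q_v : q %| v - 1.
  by apply: div_q; rewrite -mulnA -count mulnCA dvdn_mulr.
have /dvdnP[n def_c] : q %| c - 1.
  have -> : c - 1 = v - 1 - c * (d - 1) by rewrite def_v; nia.
  by rewrite dvdn_sub // def_d mulnA dvdn_mull.
move: (gcdn _ _) def_r gcd_gt0 div_q => g def_r g_gt0 _ le_g.
have q_le_c : q <= c - 1 by rewrite def_c leq_pmull //; nia.
have q_le_d : q <= d - 1 by rewrite def_d leq_pmull //; nia.
have v_large : q ^ 2 < v by rewrite def_v; nia.
have : g ^ 2 * q ^ 2 <= lambda * (v - 1) by apply: leq_mul => //; lia.
by rewrite -count -expnMn mulnC -def_r; nia.
Qed.

Lemma replication_bound (v k lambda r c d t : nat) :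
  0 < lambda -> 1 < c -> 1 < d -> 0 < t -> v = c * d ->
  r * (k - 1) = lambda * (v - 1) -> r * t = 2 * lambda * (d - 1) ->
  r <= 4 * lambda * (k - 2).
Proof.
move=> lambda_gt0 c_gt1 d_gt1 t_gt0 def_v count class_count.
have gap : r * (2 * (k - 1)) = r * (c * t) + 2 * lambda * (c - 1).
  by rewrite [r * (c * t)]mulnCA class_count mulnCA count def_v; nia.
(* gap says that 2 (k - 1) - c t is a positive integer, hence at least 1. *)
have ct_small : c * t < 2 * (k - 1) by nia.
have le_c : c - 1 <= 2 * (k - 2) by nia.
have : r <= 2 * lambda * (c - 1) by nia.
by nia.
Qed.

Lemma gcd_bound (v k lambda r c d t : nat) :
  0 < r -> 0 < lambda -> 1 < c -> 1 < d -> v = c * d ->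
  r * (k - 1) = lambda * (v - 1) -> r * t = 2 * lambda * (d - 1) ->
  2 < gcdn (v - 1) (2 * k - 2).
Proof.
move=> r_gt0 lambda_gt0 c_gt1 d_gt1 def_v count class_count.
have ratio : (2 * k - 2) * (d - 1) = t * (v - 1).
  suff : lambda * r * ((2 * k - 2) * (d - 1)) = lambda * r * (t * (v - 1)).
    by move/eqP; rewrite eqn_pmul2l ?muln_gt0 ?lambda_gt0 // => /eqP.
  transitivity ((r * (k - 1)) * (2 * lambda * (d - 1))); first by nia.
  by rewrite count -class_count; nia.
have : v - 1 %| gcdn (v - 1) (2 * k - 2) * (d - 1).
  by rewrite muln_gcdl dvdn_gcd dvdn_mulr // ratio dvdn_mull.
rewrite ltnNge => /dvdn_leq le_v; apply/negP=> gcd_le2.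
have v1_gt0 : 0 < v - 1 by nia.
have d1_gt0 : 0 < d - 1 by lia.
have := le_v; rewrite muln_gt0 gcdn_gt0 v1_gt0 d1_gt0 => /(_ isT).
by nia.
Qed.

Theorem theorem1 (T : finType) (B : {set {set T}}) (v k lambda r : nat)
  (G : {group {perm T}}) :
  is_2design B v k lambda ->
  nontrivial_design v k ->
  replication_number B r ->
  G \subset design_aut B ->
  half_flag_transitive B k G ->
  [/\ gcdn r (2 * lambda) ^ 2 <= lambda -> point_primitive G,
      4 * lambda * (k - 2) < r -> point_primitive G
    & gcdn (v - 1) (2 * k - 2) <= 2 -> point_primitive G].
Proof.
move=> desB [k_gt2 k_ltv] repB _ hftG; have [_ _ _ lambda_gt0] := desB.
have v_gt0 : 0 < v by lia.
have count := design_point_count desB repB v_gt0.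
have lt_lr : lambda < r by nia.
have r_gt0 : 0 < r by lia.
have le_kr : k <= r.
  rewrite -(leq_pmul2l v_gt0) -(design_flag_count desB repB) leq_mul2r.
  by rewrite (fisher desB repB lt_lr) orbT.
have params := imprimitive_parameters desB repB v_gt0 lt_lr hftG.
split; apply: contraTT => /params[c [d [t [c_gt1 d_gt1 t_gt0 def_v t_count]]]].
- rewrite -ltnNge.
  exact: (gcd_square_bound r_gt0 le_kr _ _ _ def_v count t_count).
- rewrite -leqNgt.
  exact: (replication_bound _ _ _ t_gt0 def_v count t_count).
- rewrite -ltnNge.
  exact: (gcd_bound r_gt0 lambda_gt0 _ _ def_v count t_count).
Qed.
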